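(* Let $G$ be a compact Hausdorff abelian group with Haar probability measure $\mu$, let $\alpha$ be a real number, and let $A,B$ be $K$-analytic subsets of $G$ satisfying $0<\mu(A+B)\leq \alpha\,\mu(A)$. Then for all non-negative integers $m,n$ we have $\mu(mB-nB)\leq \alpha^{m+n}\mu(A)$.
   Context: A subset $S$ of a topological space $Y$ is a $K_{\sigma\delta}$ set if $S=\bigcap_{i\in\mathbb{N}}\bigcup_{j\in\mathbb{N}}K_{i,j}$ for compact sets $K_{i,j}\subset Y$. A subset $A$ of a Hausdorff space $X$ is $K$-analytic if there is a $K_{\sigma\delta}$ set $S$ in some compact Hausdorff space and a continuous map $f:S\to X$ with $A=f(S)$. ($K$-analytic subsets of $G$ are Haar measurable.) For $m,n\ge 0$, $mB-nB=\{b_1+\dots+b_m-b_1'-\dots-b_n': b_i,b_j'\in B\}$, with the convention that an empty sum is $0$. *)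

(* Defs.v *)
From HB Require Import structures.
From mathcomp Require Import all_boot all_order all_algebra.
From mathcomp Require Import all_classical all_reals all_analysis.
Set Implicit Arguments. Unset Strict Implicit. Unset Printing Implicit Defensive.
Import Order.TTheory GRing.Theory Num.Theory.
Local Open Scope classical_set_scope.
Local Open Scope ring_scope.

Definition K_sigma_delta (Y : topologicalType) (S : set Y) : Prop :=
  exists K : nat -> nat -> set Y,
    (forall i j, compact (K i j)) /\ S = \bigcap_i \bigcup_j K i j.

Definition K_analytic (X : topologicalType) (A : set X) : Prop :=
  exists (Y : topologicalType) (S : set Y) (f : Y -> X),
    [/\ hausdorff_space Y, compact [set: Y], K_sigma_delta S,
        {within S, continuous f} & A = f @` S].

Definition sumset (G : zmodType) (A B : set G) : set G :=
  [set a + b | a in A & b in B].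

Fixpoint nsumset (G : zmodType) (n : nat) (B : set G) : set G :=
  match n with
  | 0%N => [set 0]
  | k.+1 => sumset B (nsumset k B)
  end.

Definition diffsumset (G : zmodType) (m n : nat) (B : set G) : set G :=
  sumset (nsumset m B) [set - x | x in nsumset n B].

(* mu : set G -> \bar R is the (completed) Haar probability measure of the
   compact Hausdorff abelian group G, with M its sigma-algebra of measurable
   sets (= completion of the Borel sets). *)
Record haar_probability (R : realType) (G : topologicalZmodType)
    (M : set (set G)) (mu : set G -> \bar R) : Prop := HaarProbability {
  haar_sigma : sigma_algebra setT M;
  haar_open : forall U : set G, open U -> M U;
  haar_complete : forall N E : set G, M N -> mu N = 0%E -> E `<=` N -> M E;
  haar_mu0 : mu set0 = 0%E;
  haar_ge0 : forall E, M E -> (0 <= mu E)%E;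
  haar_sigma_additive : forall F : nat -> set G, (forall i, M (F i)) ->
      trivIset setT F ->
      (fun n => \sum_(0 <= i < n) mu (F i))%E @ \oo --> mu (\bigcup_n F n);
  haar_prob : mu setT = 1%E;
  haar_translateM : forall (x : G) E, M E -> M [set x + y | y in E];
  haar_invariant : forall (x : G) E, M E -> mu [set x + y | y in E] = mu E;
  haar_outer_regular : forall E, M E ->
      mu E = ereal_inf [set mu U | U in [set U | open U /\ E `<=` U]];
  haar_inner_regular : forall U, open U ->
      mu U = ereal_sup [set mu K | K in [set K | compact K /\ K `<=` U]] }.

(* Main.v *)
(* K-analytic sets are measurable and can be approximated from inside by compact
   sets (Choquet), also when size is measured by [mu (mB - nB)]; this reduces
   the inequality to compact [A] and [B].  Following Petridis, one picks [X] in
   [A] almost minimising [mu (X + B + U) / mu X] for a small neighbourhood [U]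
   of [0], and gets [mu (X + jF) <= beta ^ j * mu X] for finite [F] in [B], at
   the price of an error proportional to the number of elements of [jF].  The
   thickening by [U] lets [F] and the error be fixed before [X] is chosen, and
   still controls [X + jB].  Ruzsa's triangle inequality
   [mu X * mu (Y - Z) <= mu (X + Y) * mu (X + Z)] concludes. *)
Require Import Defs.
From HB Require Import structures.
From mathcomp Require Import all_boot all_order all_algebra.
From mathcomp Require Import all_classical all_reals all_analysis.
From mathcomp Require Import ring lra.
Import Order.TTheory GRing.Theory Num.Theory.
Local Open Scope classical_set_scope.
Local Open Scope ring_scope.

(** * Algebra of sumsets and iterated sumsets *)

Section sumsets.
Variable G : zmodType.
Implicit Types A B C : set G.

Lemma mem_sumset A B a b : A a -> B b -> sumset A B (a + b).
Proof. by move=> Aa Bb; exists a => //; exists b. Qed.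

Lemma sumsetS A A' B B' : A `<=` A' -> B `<=` B' ->
  sumset A B `<=` sumset A' B'.
Proof. by move=> sA sB _ [a Aa [b Bb <-]]; apply: mem_sumset; auto. Qed.

Lemma sumsetC A B : sumset A B = sumset B A.
Proof.
by apply/seteqP; split=> _ [a Aa [b Bb <-]]; rewrite addrC; exact: mem_sumset.
Qed.

Lemma sumsetA A B C : sumset A (sumset B C) = sumset (sumset A B) C.
Proof.
apply/seteqP; split=> [_ [a Aa [_ [b Bb [c Cc <-]] <-]]|
    _ [_ [a Aa [b Bb <-]] [c Cc <-]]].
  by rewrite addrA; do 2!apply: mem_sumset => //.
by rewrite -addrA; do 2!apply: mem_sumset => //.
Qed.

Lemma sumset0 A : sumset A [set 0] = A.
Proof.
apply/seteqP; split=> [_ [a Aa [_ -> <-]]|a Aa]; first by rewrite addr0.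
by rewrite -[a]addr0; exact: mem_sumset.
Qed.

Lemma sumset1 x B : sumset [set x] B = [set x + y | y in B].
Proof.
apply/seteqP; split=> [_ [a -> [b Bb <-]]|_ [b Bb <-]]; first by exists b.
exact: mem_sumset.
Qed.

Lemma sumset_bigcup A B : sumset A B = \bigcup_(x in A) [set x + y | y in B].
Proof.
by apply/seteqP; split=> [_ [a Aa [b Bb <-]]|_ [a Aa [b Bb <-]]];
  exists a => //; exists b.
Qed.

Lemma mem_translate (x : G) A y : [set x + z | z in A] y <-> A (y - x).
Proof.
split=> [[z Az <-]|Ayx]; first by rewrite addrAC subrr add0r.
by exists (y - x) => //; rewrite addrC subrK.
Qed.

Lemma nsumsetS n A B : A `<=` B -> nsumset n A `<=` nsumset n B.
Proof. by move=> sAB; elim: n => //= n IHn; exact: sumsetS. Qed.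

Lemma nsumset_sumset n A B :
  nsumset n (sumset A B) `<=` sumset (nsumset n A) (nsumset n B).
Proof.
elim: n => [|n IHn] /=; first by rewrite sumset0.
move=> _ [_ [a Aa [b Bb <-]] [_ /IHn[x Ax [y By <-]] <-]].
by rewrite addrACA; do 2!apply: mem_sumset => //.
Qed.

Lemma diffsumsetS m n A B : A `<=` B -> diffsumset m n A `<=` diffsumset m n B.
Proof.
by move=> sAB; apply: sumsetS; [|apply: image_subset]; exact: nsumsetS.
Qed.

Lemma diffsumset_sumset m n A B : diffsumset m n (sumset A B) `<=`
  sumset (diffsumset m n A) (diffsumset m n B).
Proof.
move=> z [x /nsumset_sumset[a Aa [b Bb <-]]].
move=> [_ [y /nsumset_sumset[c Ac [d Bd <-]] <-] <-].
rewrite opprD addrACA.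
by apply: mem_sumset; apply: mem_sumset => //; [exists c|exists d].
Qed.

(** The size of the list [t] is what later bounds the accumulated error in the Petridis step. *)
Lemma nsumset_seq n (s : seq G) :
  exists t : seq G, nsumset n [set` s] = [set` t].
Proof.
apply/finite_seqP; elim: n => [|n IHn] /=; first exact: finite_set1.
by apply: finite_image2 => //; apply/finite_seqP; exists s.
Qed.

(** A sum of [n] terms meets only finitely many members of the increasing family, so the largest of
    them contains all its terms. Capacitability needs this continuity along increasing unions. *)
Lemma nsumset_bigcup n (E : nat -> set G) :
  {homo E : i j / (i <= j)%N >-> i `<=` j} ->
  nsumset n (\bigcup_i E i) `<=` \bigcup_i nsumset n (E i).
Proof.
move=> ndE; elim: n => [x ->|n IHn] /=; first by exists 0%N.
move=> _ [a [i _ Ea] [b /IHn[j _ Eb] <-]].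
exists (maxn i j) => //; apply: mem_sumset.
  by apply: ndE Ea; exact: leq_maxl.
by apply: nsumsetS Eb; apply: ndE; exact: leq_maxr.
Qed.

Lemma diffsumset_bigcup m n (E : nat -> set G) :
  {homo E : i j / (i <= j)%N >-> i `<=` j} ->
  diffsumset m n (\bigcup_i E i) `<=` \bigcup_i diffsumset m n (E i).
Proof.
move=> ndE z [a + [_ [b + <-] <-]].
move=> /(nsumset_bigcup _ _ ndE)[i _ Ea] /(nsumset_bigcup _ _ ndE)[j _ Eb].
exists (maxn i j) => //; apply: mem_sumset.
  by apply: nsumsetS Ea; apply: ndE; exact: leq_maxl.
by exists b => //; apply: nsumsetS Eb; apply: ndE; exact: leq_maxr.
Qed.

End sumsets.

(** * Sumsets of open and compact sets, neighbourhoods of [0] *)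

Section topological_sumsets.
Variable G : topologicalZmodType.
Implicit Types A B C U V W X : set G.

Lemma open_translate (x : G) U : open U -> open [set x + y | y in U].
Proof.
move=> oU.
have -> : [set x + y | y in U] = (fun y => y - x) @^-1` U.
  by apply/seteqP; split=> y /mem_translate.
apply: open_comp => // y _.
exact: (cvg_comp2 cvg_id (cvg_cst (- x)) (add_continuous (y, - x))).
Qed.

Lemma open_sumset A U : open U -> open (sumset A U).
Proof.
by move=> oU; rewrite sumset_bigcup; apply: bigcup_open => x _;
  exact: open_translate.
Qed.

Lemma compact_sumset A B : compact A -> compact B -> compact (sumset A B).
Proof.
move=> cA cB.
have -> : sumset A B = (fun z : G * G => z.1 + z.2) @` (A `*` B).
  apply/seteqP; split=> [_ [a Aa [b Bb <-]]|_ [[a b] [/= Aa Bb] <-]].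
    by exists (a, b).
  exact: mem_sumset.
apply: continuous_compact; last exact: compact_setX.
by apply: continuous_subspaceT => z; exact: add_continuous.
Qed.

Lemma compact_translate (x : G) A : compact A -> compact [set x + y | y in A].
Proof. by rewrite -sumset1; apply: compact_sumset; exact: compact_set1. Qed.

Lemma compact_opp A : compact A -> compact [set - x | x in A].
Proof.
apply: continuous_compact; apply: continuous_subspaceT => z.
exact: opp_continuous.
Qed.

Lemma compact_nsumset n A : compact A -> compact (nsumset n A).
Proof.
move=> cA; elim: n => [|n IHn]; first exact: compact_set1.
exact: compact_sumset.
Qed.

Lemma compact_diffsumset m n A : compact A -> compact (diffsumset m n A).
Proof.
by move=> cA; apply: compact_sumset; [|apply: compact_opp];
  exact: compact_nsumset.
Qed.

Lemma compact_seq (s : seq G) : compact [set` s].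
Proof.
rewrite [[set` s]](_ : _ = \big[setU/set0]_(x <- s) [set x]).
  by apply: bigsetU_compact => x _; exact: compact_set1.
by rewrite -bigcup_seq; apply/seteqP; split=> [x sx|x [y sy ->]] //; exists x.
Qed.

Lemma open_nbhs0_sub U : nbhs (0 : G) U ->
  exists V, [/\ open V, V 0 & V `<=` U].
Proof.
rewrite nbhsE => -[V [oV V0] VU]; by exists V.
Qed.

Lemma nbhs0_sumset U : nbhs (0 : G) U ->
  exists V, [/\ open V, V 0 & sumset V V `<=` U].
Proof.
move=> U0; have : nbhs ((0, 0) : G * G) ((fun z => z.1 + z.2) @^-1` U).
  by apply: add_continuous; rewrite /= addr0.
case=> -[P Q] /= [P0 Q0] PQ.
have [V [oV V0 VPQ]] := open_nbhs0_sub _ (filterI P0 Q0).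
exists V; split=> // _ [a /VPQ[Pa _] [b /VPQ[_ Qb] <-]].
exact: (PQ (a, b)).
Qed.

Lemma nbhs0_nsumset N U : nbhs (0 : G) U -> exists V,
  [/\ open V, V 0 & forall n, (n <= N)%N -> nsumset n V `<=` U].
Proof.
elim: N U => [|N IHN] U U0.
  have [V [oV V0 VU]] := open_nbhs0_sub _ U0.
  exists V; split=> // n; rewrite leqn0 => /eqP -> _ ->; exact: nbhs_singleton.
have [W [oW W0 WU]] := nbhs0_sumset _ U0.
have [V [oV V0 VW]] := IHN W (open_nbhs_nbhs (conj oW W0)).
(* A sum of [n.+1] terms is one term in [W] plus a sum of [n] terms, which lies in [W] by the choice
   of [V]. *)
exists (W `&` V); split=> //; first exact: openI.
case=> [|n] leN /=; first by move=> _ ->; exact: nbhs_singleton.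
apply: subset_trans WU; apply: sumsetS => //.
by apply: subset_trans (VW n leN); exact: nsumsetS.
Qed.

Lemma nbhs0_diffsumset m n U : nbhs (0 : G) U ->
  exists V, [/\ open V, V 0 & diffsumset m n V `<=` U].
Proof.
move=> U0; have [W [oW W0 WU]] := nbhs0_sumset _ U0.
have nW : nbhs (0 : G) (W `&` -%R @^-1` W).
  apply: filterI; first exact: (open_nbhs_nbhs (conj oW W0)).
  apply: opp_continuous; rewrite oppr0; exact: (open_nbhs_nbhs (conj oW W0)).
have [V [oV V0 VW]] := nbhs0_nsumset (maxn m n) _ nW.
exists V; split=> //; apply: subset_trans WU; apply: sumsetS.
  by move=> x /(VW _ (leq_maxl _ _))[].
by move=> _ [x /(VW _ (leq_maxr _ _))[_ Wx] <-].
Qed.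

(** Continuity of addition at [(x, 0)] gives, for each [x] in [C], a neighbourhood of [0] valid near
    [x]; compactness makes it uniform. *)
Lemma compact_sub_open C W : compact C -> open W -> C `<=` W ->
  exists U, [/\ open U, U 0 & sumset C U `<=` W].
Proof.
move=> /compact_near_coveringP cC oW CW.
have : \forall u \near (0 : G), C `<=` (fun x => W (x + u)).
  apply: cC => x Cx.
  have : nbhs ((x, 0) : G * G) ((fun z => z.1 + z.2) @^-1` W).
    by apply: add_continuous; apply: open_nbhs_nbhs; split=> //=;
      rewrite addr0; exact: CW.
  by case=> -[P Q] /= [Px Q0] PQ; exists (P, Q).
move=> /open_nbhs0_sub[U [oU U0 UP]]; exists U; split=> //.
by move=> _ [x Cx [u /UP Pu <-]]; exact: Pu.
Qed.

Lemma compact_finite_cover B V : compact B -> open V -> V 0 ->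
  exists s : seq G, [set` s] `<=` B /\ B `<=` sumset [set` s] V.
Proof.
move=> cB oV V0.
(* [F] consists of the properties shared by all lists that contain a certain finite part of [B].
   Compactness along this filter yields one list that serves every point of [B]. *)
pose F : set_system (seq G) := fun P => exists s0 : seq G,
  [set` s0] `<=` B /\ forall s : seq G, [set` s0] `<=` [set` s] -> P s.
have : F (fun s => B `<=` (fun x => exists2 b, b \in s & V (x - b))).
  apply: ((compact_near_coveringP B).1 cB _ F
    (fun s x => exists2 b, b \in s & V (x - b))).
    rewrite /F; split=> [|P Q [s [sB sP]] [t [tB tQ]]|P Q PQ [s [sB sP]]].
    - by exists [::].
    - exists (s ++ t); split=> [x /=|u stu].
        by rewrite mem_cat => /orP[/sB|/tB].
      by split; [apply: sP|apply: tQ] => x xs; apply: stu;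
        rewrite /= mem_cat xs ?orbT.
    - by exists s; split=> // t st; apply: PQ; exact: sP.
  move=> x Bx; exists ([set x + v | v in V], [set s : seq G | x \in s]).
    split=> /=.
      apply: open_nbhs_nbhs; split; first exact: open_translate.
      by exists 0 => //; rewrite addr0.
    exists [:: x]; split=> [y /=|s]; first by rewrite inE => /eqP ->.
    by apply=> /=; rewrite inE.
  move=> [y s] /= [[v Vv <-] xs]; exists x => //.
  by rewrite addrAC subrr add0r.
move=> [s [sB /(_ s (@subset_refl _ _)) Bs]]; exists s.
split=> // x /Bs[b bs Vxb].
by exists b => //; exists (x - b) => //; rewrite addrC subrK.
Qed.

(** Capacitability only controls open neighbourhoods of [C]; this carries that control over to the
    neighbourhoods of [diffsumset m n C]. *)
Lemma diffsumset_open_nbhs m n C W : compact C -> open W ->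
  diffsumset m n C `<=` W ->
  exists U, [/\ open U, C `<=` U & diffsumset m n U `<=` W].
Proof.
move=> cC oW CW.
have [N [oN N0 NW]] := compact_sub_open _ _ (compact_diffsumset m n _ cC) oW CW.
have [V [oV V0 VN]] := nbhs0_diffsumset m n _ (open_nbhs_nbhs (conj oN N0)).
exists (sumset C V); split; first exact: open_sumset.
  by move=> x Cx; rewrite -[x]addr0; exact: mem_sumset.
apply: subset_trans (@diffsumset_sumset _ _ _ _ _) _.
by apply: subset_trans NW; exact: sumsetS.
Qed.

End topological_sumsets.

(** * K-analytic sets: stability and capacitability *)

Lemma hausdorff_prod (X Y : topologicalType) :
  hausdorff_space X -> hausdorff_space Y -> hausdorff_space (X * Y)%type.
Proof.
move=> hX hY [x y] [x' y'] clxy; congr pair.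
  apply: hX => P Q Px Qx'.
  have [] := clxy (P `*` setT) (Q `*` setT).
  - by exists (P, setT) => //; split=> //; exact: filterT.
  - by exists (Q, setT) => //; split=> //; exact: filterT.
  by move=> [u v] [[/= Pu _] [/= Qu _]]; exists u.
apply: hY => P Q Py Qy'.
have [] := clxy (setT `*` P) (setT `*` Q).
- by exists (setT, P) => //; split=> //; exact: filterT.
- by exists (setT, Q) => //; split=> //; exact: filterT.
by move=> [u v] [[/= _ Pv] [/= _ Qv]]; exists v.
Qed.

Lemma compact_K_analytic (X : topologicalType) (A : set X) :
  hausdorff_space X -> compact [set: X] -> compact A -> K_analytic A.
Proof.
move=> hX cX cA; exists X, A, id; split=> //.
- exists (fun _ _ => A); split=> //; apply/seteqP; split=> x.
    by move=> Ax i _; exists 0%N.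
  by case/(_ 0%N I).
- by apply: continuous_subspaceT => x; exact: cvg_id.
- by rewrite image_id.
Qed.

Lemma image_K_analytic (X Z : topologicalType) (g : X -> Z) (A : set X) :
  continuous g -> K_analytic A -> K_analytic (g @` A).
Proof.
move=> cg [Y [S [f [hY cY KS cf ->]]]]; exists Y, S, (g \o f); split=> //.
  by move=> y; exact: continuous_comp (cf y) (cg _).
by rewrite image_comp.
Qed.

Lemma K_analytic_setX (X X' : topologicalType) (A : set X) (B : set X') :
  K_analytic A -> K_analytic B -> K_analytic (A `*` B).
Proof.
move=> [Y [S [f [hY cY [K [cK SE]] cf ->]]]].
move=> [Z [T [g [hZ cZ [L [cL TE]] cg ->]]]].
exists (Y * Z)%type, (S `*` T), (fun z => (f z.1, g z.2)); split.
- exact: hausdorff_prod.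
- by rewrite -setXTT; exact: compact_setX.
(* The union over pairs [(j, l)] is indexed by their codes [k]; a number that codes no pair
   contributes the empty set. *)
- exists (fun i k =>
    if unpickle k is Some (j, l) then K i j `*` L i l else set0).
  split=> [i k|].
    by case: unpickle => [[j l]|]; [exact: compact_setX|exact: compact0].
  apply/seteqP; split=> [[y z] [/= Sy Tz] i _|[y z] STyz].
    move: Sy Tz; rewrite SE TE => /(_ i I)[j _ Ky] /(_ i I)[l _ Lz].
    by exists (pickle (j, l)) => //; rewrite pickleK.
  by split=> /=; rewrite ?SE ?TE => i _; have [k _] := STyz i I;
    case: unpickle => [[j l] /= [/= Ky Lz]|[]]; [exists j|exists l].
- move/subspace_continuousP : cf => cf; move/subspace_continuousP : cg => cg.
  apply/subspace_continuousP => -[y z] [/= Sy Tz].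
  apply: cvg_pair.
    move=> P /(cf y Sy) SP; exists ([set u | S u -> P (f u)], setT).
      by split=> //=; exact: filterT.
    by move=> [u v] /= [SPu _] [/SPu].
  move=> P /(cg z Tz) TP; exists (setT, [set v | T v -> P (g v)]).
    by split=> //=; exact: filterT.
  by move=> [u v] /= [_ TPv] [_ /TPv].
- apply/seteqP; split=> [[_ _] [/= [y Sy <-] [z Tz <-]]|_ [[y z] [Sy Tz] <-]].
    by exists (y, z).
  by split; [exists y|exists z].
Qed.

Lemma K_analytic_sumset (G : topologicalZmodType) (A B : set G) :
  K_analytic A -> K_analytic B -> K_analytic (sumset A B).
Proof.
move=> kA kB.
have -> : sumset A B = (fun z : G * G => z.1 + z.2) @` (A `*` B).
  apply/seteqP; split=> [_ [a Aa [b Bb <-]]|_ [[a b] [/= Aa Bb] <-]].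
    by exists (a, b).
  exact: mem_sumset.
apply: image_K_analytic; last exact: K_analytic_setX.
by move=> z; exact: add_continuous.
Qed.

Lemma K_analytic_diffsumset (G : topologicalZmodType) m n (A : set G) :
  hausdorff_space G -> compact [set: G] ->
  K_analytic A -> K_analytic (diffsumset m n A).
Proof.
move=> hG cG kA.
have kn k : K_analytic (nsumset k A).
  elim: k => [|k IHk] /=; last exact: K_analytic_sumset.
  by apply: compact_K_analytic => //; exact: compact_set1.
apply: K_analytic_sumset => //; apply: image_K_analytic => //.
exact: opp_continuous.
Qed.

(* Choquet's capacitability argument: [j_ n] is chosen so that intersecting [S]
   with [K n (j_ n)] keeps [phi] of the image above [t]; the intersection of
   the chosen compact sets lies in [S], and its image is the compact set. *)
Lemma capacitability (R : realType) (X : topologicalType) (phi : set X -> R)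
    (A : set X) (t : R) :
  (forall E F, E `<=` F -> phi E <= phi F) ->
  (forall E : nat -> set X, {homo E : i j / (i <= j)%N >-> i `<=` j} ->
     t < phi (\bigcup_i E i) -> exists i, t < phi (E i)) ->
  K_analytic A -> t < phi A ->
  exists C, [/\ compact C, C `<=` A &
    forall U, open U -> C `<=` U -> t < phi U].
Proof.
move=> phiS phiU [Y [S [f [hY cY [K [cK SE]] cf ->]]]] tA.
(* Finite unions make the family increasing in [j], as the hypothesis on increasing unions
   demands. *)
pose L i j := \big[setU/set0]_(k < j.+1) K i k.
have cL i j : compact (L i j) by apply: bigsetU_compact.
have ndL i : {homo L i : j k / (j <= k)%N >-> j `<=` k}.
  by move=> j k jk; apply: subset_bigsetU.
have SL i : S `<=` \bigcup_j L i j.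
  rewrite SE => y /(_ i I)[j _ Kij]; exists j => //.
  by rewrite /L big_ord_recr /=; right.
have step n Z : Z `<=` S -> t < phi (f @` Z) ->
    exists j, t < phi (f @` (Z `&` L n j)).
  move=> ZS tZ; apply: (phiU (fun j => f @` (Z `&` L n j))).
    by move=> j k jk; apply: image_subset; apply: setIS; exact: ndL.
  apply: lt_le_trans tZ _; apply: phiS => _ [y Zy <-].
  by have [j _ Lj] := SL n y (ZS y Zy); exists j => //; exists y.
(* The conditions on the set stand under the existential, so that [j_] is total and can drive the
   recursion defining [Z]. *)
have /choice[j_ j_P] : forall nZ : nat * set Y, exists j, nZ.2 `<=` S ->
    t < phi (f @` nZ.2) -> t < phi (f @` (nZ.2 `&` L nZ.1 j)).
  move=> [n Z] /=; have [ZS|nZS] := pselect (Z `<=` S); last by exists 0%N.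
  have [tZ|ntZ] := pselect (t < phi (f @` Z)); last by exists 0%N.
  by have [j tj] := step n Z ZS tZ; exists j.
pose Z := fix Z n := if n is k.+1 then Z k `&` L k (j_ (k, Z k)) else S.
pose H n := L n (j_ (n, Z n)).
have ZS n : Z n `<=` S by elim: n => //= n IHn y [/IHn].
have tZ n : t < phi (f @` Z n).
  by elim: n => // n IHn; exact: (j_P (n, Z n) (ZS n) IHn).
have ZE n y : S y -> (forall i, (i < n)%N -> H i y) -> Z n y.
  elim: n => // n IHn Sy Hy; split; last exact: Hy.
  by apply: IHn => // i lin; apply: Hy; exact: ltnW.
have ZH n i y : (i < n)%N -> Z n y -> H i y.
  elim: n => // n IHn; rewrite ltnS leq_eqVlt => /predU1P[->|lin] [] //.
  by move=> Zy _; exact: IHn.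
have clH n : closed (H n) by apply: compact_closed => //; exact: cL.
pose C := \bigcap_n H n.
have CS : C `<=` S.
  rewrite SE => y Cy i _; have := Cy i I.
  rewrite /H /L -bigcup_mkord => -[j _ Kij]; by exists j.
have cC : compact C.
  by apply: subclosed_compact cY _ => //; apply: closed_bigI => n _; exact: clH.
exists (f @` C); split.
- by apply: continuous_compact => //; exact: continuous_subspaceW CS cf.
- exact: image_subset.
move=> U oU CU.
(* Compactness of [Y] gives one [n] for which [f] maps [Z n] into [U]. Near a point of [C] this is
   continuity of [f] on [S]; any other point has a neighbourhood missing some closed [H n], hence
   missing every later [Z k]. *)
have : \forall n \near \oo, [set: Y] `<=` (fun y => Z n y -> U (f y)).
  apply: ((compact_near_coveringP _).1 cY _ \oo (fun n y => Z n y -> U (f y))).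
  move=> y _; have [Cy|nCy] := pselect (C y).
    move/subspace_continuousP : cf => /(_ y (CS y Cy)) /(_ U).
    have nU : nbhs (f y) U.
      by apply: open_nbhs_nbhs; split=> //; apply: CU; exists y.
    move=> /(_ nU) nU'; exists ([set z | S z -> U (f z)], setT).
      by split=> //=; exact: filterT.
    by move=> [z n] /= [SU _] /ZS; exact: SU.
  have [n nHy] : exists n, ~ H n y.
    by apply: contrapT => /forallNP nH; apply: nCy => n _; exact: contrapT.
  exists (~` H n, [set k | (n < k)%N]) => /=.
    split; last by exists n.+1.
    by apply: open_nbhs_nbhs; split=> //; exact: closed_openC.
  by move=> [z k] /= [nHz nk] Zz; case: nHz; exact: ZH Zz.
move=> [n _ /(_ n (leqnn n)) ZU].
apply: lt_le_trans (tZ n) _; apply: phiS => _ [y Zy <-]; exact: ZU.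
Qed.

(** * Elementary properties of Haar measure, with real values *)

Section haar_measure.
Variables (R : realType) (G : topologicalZmodType).
Variables (M : set (set G)) (mu : set G -> \bar R).
Hypotheses (hG : hausdorff_space G) (cG : compact [set: G]).
Hypothesis muH : haar_probability M mu.
Implicit Types A B C D E F U X Y Z : set G.

Local Notation m E := (fine (mu E)).

Lemma haar_measurable0 : M set0.
Proof. by case: (haar_sigma muH). Qed.

Lemma haar_measurableC E : M E -> M (~` E).
Proof. by case: (haar_sigma muH) => _ MC _ /MC; rewrite setTD. Qed.

Lemma haar_measurable_bigcup (F : nat -> set G) :
  (forall n, M (F n)) -> M (\bigcup_n F n).
Proof. by case: (haar_sigma muH) => _ _; apply. Qed.

Lemma haar_measurableT : M setT.
Proof. by rewrite -setC0; exact: haar_measurableC haar_measurable0. Qed.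

Lemma haar_measurableU E F : M E -> M F -> M (E `|` F).
Proof.
move=> ME MF; rewrite -bigcup2E; apply: haar_measurable_bigcup.
by move=> [|[|n]] //=; exact: haar_measurable0.
Qed.

Lemma haar_measurableI E F : M E -> M F -> M (E `&` F).
Proof.
move=> ME MF; rewrite -[E]setCK -[F]setCK -setCU.
by apply/haar_measurableC/haar_measurableU; exact: haar_measurableC.
Qed.

Lemma haar_measurableD E F : M E -> M F -> M (E `\` F).
Proof.
by move=> ME MF; rewrite setDE; apply: haar_measurableI => //;
  exact: haar_measurableC.
Qed.

Lemma haar_measurable_bigcap (F : nat -> set G) :
  (forall n, M (F n)) -> M (\bigcap_n F n).
Proof.
move=> MF; rewrite -[\bigcap_n F n]setCK setC_bigcap.
by apply/haar_measurableC/haar_measurable_bigcup => n; exact: haar_measurableC.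
Qed.

Lemma haar_compact E : compact E -> M E.
Proof.
move=> cE; rewrite -[E]setCK; apply/haar_measurableC/(haar_open muH).
by apply: closed_openC; exact: compact_closed.
Qed.

Lemma haar_muU E F : M E -> M F -> E `&` F = set0 ->
  mu (E `|` F) = (mu E + mu F)%E.
Proof.
move=> ME MF EF0.
(* Countable additivity is applied to [E], [F] followed by empty sets; the partial sums are constant
   from rank 2 on. *)
have MEF n : M (bigcup2 E F n).
  by case: n => [|[|n]] //=; exact: haar_measurable0.
have tEF : trivIset setT (bigcup2 E F) by rewrite -trivIset_bigcup2.
have := haar_sigma_additive muH MEF tEF; rewrite bigcup2E => cvgU.
apply: (@cvg_unique _ (@ereal_hausdorff R) _ _ _ _ cvgU).
apply: cvg_near_cst; exists 2%N => // -[|[|n]] //= _.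
rewrite big_nat_recl // big_nat_recl //= big1 ?adde0 // => i _.
exact: haar_mu0 muH.
Qed.

Lemma haar_muE E : M E -> mu E = (m E)%:E.
Proof.
move=> ME; rewrite fineK // fin_numElt.
rewrite (lt_le_trans _ (haar_ge0 muH ME)) ?ltNyr //=.
apply: (@le_lt_trans _ _ 1%E); last by rewrite ltry.
rewrite -(haar_prob muH) -(setUv E) haar_muU ?setICr //.
  by apply: leeDl; apply: (haar_ge0 muH); exact: haar_measurableC.
exact: haar_measurableC.
Qed.

Lemma haar_m_ge0 E : M E -> 0 <= m E.
Proof.
by move=> ME; rewrite -lee_fin -haar_muE //; exact: haar_ge0 muH _ ME.
Qed.

Lemma haar_mT : m setT = 1.
Proof. by rewrite (haar_prob muH). Qed.

Lemma haar_m0 : m set0 = 0.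
Proof. by rewrite (haar_mu0 muH). Qed.

Lemma haar_mU E F : M E -> M F -> E `&` F = set0 -> m (E `|` F) = m E + m F.
Proof.
move=> ME MF EF0; apply: EFin_inj; rewrite EFinD -!haar_muE //.
  exact: haar_muU.
exact: haar_measurableU.
Qed.

Lemma haar_mID E F : M E -> M F -> m E = m (E `&` F) + m (E `\` F).
Proof.
move=> ME MF; rewrite -haar_mU ?setUIDK //.
- exact: haar_measurableI.
- exact: haar_measurableD.
- by apply/seteqP; split=> x // [[_ Fx] [_ /(_ Fx)]].
Qed.

Lemma haar_mS E F : M E -> M F -> E `<=` F -> m E <= m F.
Proof.
move=> ME MF EF; rewrite (@haar_mID F E) // (setIidr EF) lerDl.
by apply: haar_m_ge0; exact: haar_measurableD.
Qed.

Lemma haar_mD E F : M E -> M F -> E `<=` F -> m (F `\` E) = m F - m E.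
Proof.
by move=> ME MF EF; rewrite (@haar_mID F E) // (setIidr EF) addrAC subrr add0r.
Qed.

Lemma haar_mUD E F : M E -> M F -> m (E `|` F) = m E + m (F `\` E).
Proof.
move=> ME MF; rewrite -haar_mU //.
- congr (fine (mu _)); apply/seteqP; split=> x [Ex|]; [by left| |by left|].
    by move=> Fx; have [Ex|nEx] := pselect (E x); [left|right].
  by case=> Fx _; right.
- exact: haar_measurableD.
- by apply/seteqP; split=> x // [Ex []].
Qed.

Lemma haar_m_le1 E : M E -> m E <= 1.
Proof.
by move=> ME; rewrite -haar_mT; apply: haar_mS => //; exact: haar_measurableT.
Qed.

Lemma haar_m_translate x E : M E -> m [set x + y | y in E] = m E.
Proof. by move=> ME; rewrite (haar_invariant muH). Qed.

(** Continuity from below: the successive differences [seqD F] are disjoint and their measures add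
    up to [mu (F n)]. *)
Lemma haar_m_bigcup_le (F : nat -> set G) t : (forall n, M (F n)) ->
  {homo F : i j / (i <= j)%N >-> i `<=` j} ->
  (forall n, m (F n) <= t) -> m (\bigcup_n F n) <= t.
Proof.
move=> MF ndF Ft.
have ndF' : {homo F : i j / (i <= j)%N >-> (i <= j)%O}.
  by move=> i j /ndF; rewrite subsetEset.
have MD n : M (seqD F n) by case: n => [|n] //=; exact: haar_measurableD.
have := haar_sigma_additive muH MD (trivIset_seqD ndF').
rewrite eq_bigcup_seqD => cvgF.
rewrite -lee_fin -haar_muE; last exact: haar_measurable_bigcup.
rewrite -(cvg_lim (@ereal_hausdorff R) cvgF); apply: lime_le.
  by apply/cvg_ex; exists (mu (\bigcup_n F n)).
exists 1%N => // -[//|n] _.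
suff -> : (\sum_(0 <= i < n.+1) mu (seqD F i) = mu (F n))%E.
  by rewrite haar_muE // lee_fin.
elim: n => [|n IHn]; first by rewrite big_nat1.
rewrite big_nat_recr //= IHn -haar_muU //.
- by rewrite -[F n.+1 `\` F n]/(seqD F n.+1) -setU_seqD.
- exact: MD n.+1.
- by apply/seteqP; split=> x // [Fx []].
Qed.

(** * Outer measure, measurability and inner approximation of K-analytic sets *)

(** Defined on all sets, since capacitability is applied to sets not yet known to be measurable. *)
Definition haar_outer E : R :=
  inf [set m U | U in [set U | open U /\ E `<=` U]].

Lemma haar_outer_has_inf E :
  has_inf [set m U | U in [set U | open U /\ E `<=` U]].
Proof.
split; first by exists (m setT), setT => //; split=> //; exact: openT.
by exists 0 => _ [U [oU _] <-]; apply/haar_m_ge0/(haar_open muH).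
Qed.

Lemma haar_outer_le E U : open U -> E `<=` U -> haar_outer E <= m U.
Proof.
by move=> oU EU; apply: ge_inf; [case: (haar_outer_has_inf E)|exists U].
Qed.

Lemma haar_outer_lt E t : haar_outer E < t ->
  exists U, [/\ open U, E `<=` U & m U < t].
Proof.
move=> /inf_lt[|_ [U [oU EU] <-] Ut]; first by case: (haar_outer_has_inf E).
by exists U.
Qed.

Lemma haar_outerS E F : E `<=` F -> haar_outer E <= haar_outer F.
Proof.
move=> EF; rewrite leNgt; apply/negP => /haar_outer_lt[U [oU FU]].
apply/negP; rewrite -leNgt; apply: haar_outer_le => //.
exact: subset_trans FU.
Qed.

Lemma haar_outerE E : M E -> haar_outer E = m E.
Proof.
move=> ME; apply/eqP; rewrite eq_le; apply/andP; split.
  apply/ler_addgt0Pr => e e0.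
  have : (mu E < (m E + e)%:E)%E by rewrite haar_muE // lte_fin ltrDl.
  rewrite (haar_outer_regular muH ME) => /ereal_inf_lt[_ [U [oU EU] <-]].
  rewrite haar_muE; last exact: haar_open muH _ oU.
  rewrite lte_fin -(haar_outer_regular muH ME) => /ltW; apply: le_trans.
  exact: haar_outer_le.
rewrite leNgt; apply/negP => /haar_outer_lt[U [oU EU]].
by apply/negP; rewrite -leNgt; apply: haar_mS => //; exact: haar_open muH _ oU.
Qed.

Lemma haar_outer_hull E : exists H, [/\ M H, E `<=` H & m H <= haar_outer E].
Proof.
have /choice[U_ U_P] : forall n, exists U,
    [/\ open U, E `<=` U & m U < haar_outer E + n.+1%:R^-1].
  by move=> n; apply: haar_outer_lt; rewrite ltrDl invr_gt0.
have MU n : M (U_ n) by case: (U_P n) => oU _ _; exact: haar_open muH _ oU.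
have MH := haar_measurable_bigcap _ MU.
exists (\bigcap_n U_ n); split=> //.
  by move=> x Ex n _; case: (U_P n) => _ EU _; exact: EU.
apply/ler_addgt0Pr => e e0; have [n ne] := ltr_add_invr e0.
have : m (\bigcap_n U_ n) <= m (U_ n) by apply: haar_mS => // x; apply.
by case: (U_P n) => _ _; move: ne; rewrite add0r; move: _^-1 => r; lra.
Qed.

Lemma haar_outer_bigcup (E : nat -> set G) t :
  {homo E : i j / (i <= j)%N >-> i `<=` j} ->
  t < haar_outer (\bigcup_i E i) -> exists i, t < haar_outer (E i).
Proof.
move=> ndE tE; apply: contrapT => /forallNP Et; move: tE; apply/negP.
rewrite -leNgt.
have /choice[H H_P] := fun i => haar_outer_hull (E i).
(* The hulls [H i] need not increase, but the intersections [L i] of all hulls from rank [i] on do;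
   they still contain [E i] because [E] increases. *)
pose L i := \bigcap_k H (i + k)%N.
have ML i : M (L i).
  by apply: haar_measurable_bigcap => k; case: (H_P (i + k)%N).
have EL i : E i `<=` L i.
  move=> x Ex k _; case: (H_P (i + k)%N) => _ EH _; apply: EH.
  by apply: ndE Ex; exact: leq_addr.
have ndL : {homo L : i j / (i <= j)%N >-> i `<=` j}.
  move=> i j ij x Lx k _; have := Lx (j - i + k)%N I.
  by rewrite addnA subnKC.
apply: (@le_trans _ _ (m (\bigcup_i L i))).
  rewrite -haar_outerE; last exact: haar_measurable_bigcup.
  by apply: haar_outerS; exact: subset_bigcup.
apply: haar_m_bigcup_le => // i; case: (H_P i) => MH _ HE.
apply: (@le_trans _ _ (m (H i))); last first.
  by apply: le_trans HE _; rewrite leNgt; apply/negP; exact: Et.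
by apply: haar_mS => // x /(_ 0%N I); rewrite addn0.
Qed.

(** [A] lies between a countable union [L] of compact sets and a hull [H] of the same measure, so
    [A] differs from [L] by a subset of a null set and completeness applies. *)
Lemma haar_measurable_inner A :
  (forall t, t < haar_outer A -> exists C,
     [/\ compact C, C `<=` A & t <= m C]) ->
  M A.
Proof.
move=> innerA; have [H [MH AH HA]] := haar_outer_hull A.
have /choice[C_ C_P] : forall n, exists C,
    [/\ compact C, C `<=` A & haar_outer A - n.+1%:R^-1 <= m C].
  by move=> n; apply: innerA; rewrite ltrBlDr ltrDl invr_gt0.
have MC n : M (C_ n) by case: (C_P n) => cC _ _; exact: haar_compact.
pose L := \bigcup_n C_ n.
have ML : M L by exact: haar_measurable_bigcup.
have LA : L `<=` A by move=> x [n _ Cx]; case: (C_P n) => _ + _; apply.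
have MHL : M (H `\` L) by exact: haar_measurableD.
have HL0 : mu (H `\` L) = 0%E.
  rewrite haar_muE //; congr EFin; apply/eqP.
  rewrite eq_le haar_m_ge0 // andbT.
  apply/ler_addgt0Pr => e e0; have [n ne] := ltr_add_invr e0.
  rewrite haar_mD //; last exact: subset_trans AH.
  have : m (C_ n) <= m L by apply: haar_mS => // x Cx; exists n.
  by case: (C_P n) => _ _; move: HA ne; rewrite add0r; move: _^-1 => r; lra.
rewrite -(setDUK LA); apply: haar_measurableU => //.
by apply: haar_complete muH _ _ MHL HL0 _; exact: setSD.
Qed.

Lemma haar_K_analytic_inner A t : K_analytic A -> t < haar_outer A ->
  exists C, [/\ compact C, C `<=` A & t <= m C].
Proof.
move=> kA tA.
have [C [cC CA tC]] := capacitability _ _ haar_outer A t haar_outerS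
  (fun F : nat -> set G => haar_outer_bigcup F t) kA tA.
exists C; split=> //; rewrite -haar_outerE; last exact: haar_compact.
(* If [m C < t], outer regularity gives an open [U] around [C] with [m U < t], against the choice of
   [C]. *)
rewrite leNgt; apply/negP => /haar_outer_lt[U [oU CU Ut]].
have := lt_trans (lt_le_trans (tC U oU CU)
  (haar_outer_le _ _ oU (@subset_refl _ U))) Ut.
by rewrite ltxx.
Qed.

Lemma haar_K_analytic A : K_analytic A -> M A.
Proof.
by move=> kA; apply: haar_measurable_inner => t; exact: haar_K_analytic_inner.
Qed.

Lemma haar_diffsumset_inner k l B t : K_analytic B ->
  t < m (diffsumset k l B) ->
  exists C, [/\ compact C, C `<=` B & t <= m (diffsumset k l C)].
Proof.
move=> kB; rewrite -haar_outerE; last first.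
  by apply: haar_K_analytic; exact: K_analytic_diffsumset.
move=> tB.
have [|E ndE tE|C [cC CB tC]] :=
  capacitability _ _ (fun E : set G => haar_outer (diffsumset k l E)) B t
    _ _ kB tB.
- by move=> E F EF; apply: haar_outerS; exact: diffsumsetS.
- apply: (haar_outer_bigcup (fun i => diffsumset k l (E i))).
    by move=> i j ij; apply: diffsumsetS; exact: ndE.
  by apply: lt_le_trans tE _; apply: haar_outerS; exact: diffsumset_bigcup.
exists C; split=> //.
rewrite -haar_outerE; last by apply: haar_compact; exact: compact_diffsumset.
(* Same contradiction, after finding an open [U] around [C] with [diffsumset k l U] inside [W]. *)
rewrite leNgt; apply/negP => /haar_outer_lt[W [oW CW Wt]].
have [U [oU CU UW]] := diffsumset_open_nbhs _ _ _ _ _ cC oW CW.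
have := lt_trans (lt_le_trans (tC U oU CU) (haar_outer_le _ _ oW UW)) Wt.
by rewrite ltxx.
Qed.

(** * Convolution inequality and Ruzsa's triangle inequality *)

(** This integrates over [D] a lower bound for a simple function. Induction on [n] splits [D] along
    [E n], where the last term is constant and can be moved to the side of [c]. *)
Lemma haar_simple_le (n : nat) (p : nat -> R) (E : nat -> set G) D c :
  (forall i, M (E i)) -> M D ->
  (forall d, D d -> c <= \sum_(i < n) p i * \1_(E i) d) ->
  c * m D <= \sum_(i < n) p i * m (E i `&` D).
Proof.
move=> ME; elim: n => [|n IHn] in D c * => MD cD.
  rewrite big_ord0; have [->|/set0P[d Dd]] := eqVneq D set0.
    by rewrite haar_m0 mulr0.
  apply: mulr_le0_ge0; last exact: haar_m_ge0.
  by have := cD d Dd; rewrite big_ord0.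
have MI : M (D `&` E n) by exact: haar_measurableI.
have MD' : M (D `\` E n) by exact: haar_measurableD.
have I1 : (c - p n) * m (D `&` E n) <=
    \sum_(i < n) p i * m (E i `&` (D `&` E n)).
  apply: IHn => // d [Dd Ed]; have := cD d Dd.
  by rewrite big_ord_recr /= indicE mem_set // mulr1 lerBlDr.
have I2 : c * m (D `\` E n) <= \sum_(i < n) p i * m (E i `&` (D `\` E n)).
  apply: IHn => // d [Dd Ed]; have := cD d Dd.
  by rewrite big_ord_recr /= indicE memNset // mulr0 addr0.
rewrite (haar_mID D (E n)) // big_ord_recr /= [E n `&` D]setIC.
rewrite (eq_bigr (fun i : 'I_n => p i * m (E i `&` (D `&` E n)) +
    p i * m (E i `&` (D `\` E n)))); first by rewrite big_split /=; lra.
move=> i _; rewrite -mulrDr (haar_mID (E i `&` D) (E n)) //.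
  by rewrite setIA setIDA.
exact: haar_measurableI.
Qed.

(** Produces a simple function of integral [m P * m W] above the convolution of [P] and [Q], by
    cutting [P] into disjoint pieces, each in a translate of [V]. *)
Lemma haar_cover_simple (s : seq G) V W P Q :
  open V -> open W -> sumset [set - q | q in Q] V `<=` W -> M Q -> M P ->
  P `<=` sumset [set` s] V ->
  exists n (p : nat -> R) (E : nat -> set G),
    [/\ forall i, 0 <= p i, forall i, M (E i),
        \sum_(i < n) p i * m (E i) = m P * m W &
        forall d, m (P `&` [set d + q | q in Q]) <=
          \sum_(i < n) p i * \1_(E i) d].
Proof.
move=> oV oW QVW MQ; elim: s => [|t s IHs] in P * => MP Ps.
  have P0 : P = set0 by apply/seteqP; split=> // x /Ps[].
  exists 0%N, (fun=> 0), (fun=> set0); split=> //.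
  - by move=> _; exact: haar_measurable0.
  - by rewrite big_ord0 P0 haar_m0 mul0r.
  - by move=> d; rewrite big_ord0 P0 set0I haar_m0.
have MtV : M [set t + v | v in V] by exact/(haar_open muH)/open_translate.
have MtW : M [set t + w | w in W] by exact/(haar_open muH)/open_translate.
pose P1 := P `&` [set t + v | v in V].
pose P2 := P `\` [set t + v | v in V].
have MP1 : M P1 by exact: haar_measurableI.
have MP2 : M P2 by exact: haar_measurableD.
have [|n [p [E [p0 ME sumE dE]]]] := IHs P2 MP2.
  move=> x [Px nx]; have [a + [v Vv avx]] := Ps x Px.
  rewrite /= inE => /predU1P[at_|sa]; last by exists a => //; exists v.
  by case: nx; exists v => //; rewrite -at_.
(* The piece [P1] contributes at most [m P1], and only when [d + Q] meets [t + V]; this forces [d]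
   into [t + V - Q], hence into [t + W]. *)
exists n.+1, (fun i => if i is j.+1 then p j else m P1),
  (fun i => if i is j.+1 then E j else [set t + w | w in W]); split.
- by case=> [|i] //; exact: haar_m_ge0.
- by case.
- rewrite big_ord_recl /= sumE haar_m_translate; last exact: (haar_open muH).
  by rewrite -mulrDl -haar_mID.
move=> d; rewrite big_ord_recl /=.
have MdQ : M [set d + q | q in Q] by exact: (haar_translateM muH).
rewrite (haar_mID (P `&` [set d + q | q in Q]) [set t + v | v in V]) //;
  last exact: haar_measurableI.
apply: lerD; last first.
  by have := dE d; rewrite /P2 setIDAC setIDA.
rewrite setIAC -/P1 indicE; have [tWd|ntWd] := boolP (d \in _).
  rewrite mulr1; apply: haar_mS => //; exact: haar_measurableI.
rewrite mulr0 (_ : _ `&` _ = set0) ?haar_m0 //.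
apply/seteqP; split=> // x [[_ [v Vv tvx]] [q Qq dqx]].
move/negP : ntWd; apply; rewrite inE /=; exists (- q + v).
  by apply: QVW; apply: mem_sumset => //; exists q.
by rewrite addrCA tvx -dqx addrCA addNr addr0.
Qed.

(* [d |-> m (P `&` (d + Q))] has integral [m P * m (- Q)]; only this Markov-type
   consequence is needed, and it follows from finite covers of [P] by small
   translates without integrating over the product space. *)
Lemma haar_convolution_le P Q D c : compact P -> compact Q -> M D ->
  (forall d, D d -> c <= m (P `&` [set d + q | q in Q])) ->
  c * m D <= m P * m [set - q | q in Q].
Proof.
move=> cP cQ MD cD.
have MP := haar_compact _ cP; have MQ := haar_compact _ cQ.
have cNQ := compact_opp _ _ cQ; have MNQ := haar_compact _ cNQ.
have cDW W : open W -> [set - q | q in Q] `<=` W -> c * m D <= m P * m W.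
  move=> oW QW.
  have [V [oV V0 QVW]] := compact_sub_open _ _ _ cNQ oW QW.
  have [s [_ Ps]] := compact_finite_cover _ _ _ cP oV V0.
  have [n [p [E [p0 ME <- dE]]]] :=
    haar_cover_simple s V W P Q oV oW QVW MQ MP Ps.
  apply: (@le_trans _ _ (\sum_(i < n) p i * m (E i `&` D))).
    by apply: haar_simple_le => // d /cD cd; exact: le_trans cd (dE d).
  apply: ler_sum => i _; apply: ler_wpM2l => //.
  by apply: haar_mS => //; exact: haar_measurableI.
(* Outer regularity lets [W] shrink to [-Q]; since [m P <= 1], an excess [e] in [m W] costs at most
   [e]. *)
apply/ler_addgt0Pr => e e0.
have [|U [oU QU Ue]] :=
    haar_outer_lt [set - q | q in Q] (m [set - q | q in Q] + e).
  by rewrite haar_outerE // ltrDl.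
apply: le_trans (cDW U oU QU) _.
have := haar_m_le1 _ MP; have := haar_m_ge0 _ MP; nra.
Qed.

(** The convolution inequality with [P = D = G] and [-Q] in place of [Q]: by invariance the
    convolution is then constantly [m (-Q)]. *)
Lemma haar_m_opp_le Q : compact Q -> m [set - q | q in Q] <= m Q.
Proof.
move=> cQ; have cNQ := compact_opp _ _ cQ.
have := haar_convolution_le setT _ setT (m [set - q | q in Q]) cG cNQ
  haar_measurableT.
rewrite haar_mT mulr1 mul1r (_ : [set - q | q in [set - q | q in Q]] = Q).
  by apply=> d _; rewrite setTI haar_m_translate //; exact: haar_compact.
apply/seteqP; split=> [_ [_ [q Qq <-] <-]|q Qq]; first by rewrite opprK.
by exists (- q); [exists q|rewrite opprK].
Qed.

(** For [d = y - z] the set [y + X] lies in both [X + Y] and [d + (X + Z)], since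
    [y + x = d + (x + z)]. So the convolution of [X + Y] and [X + Z] is at least [m X] on
    [Y - Z]. *)
Lemma haar_ruzsa_triangle X Y Z : compact X -> compact Y -> compact Z ->
  m X * m (sumset Y [set - z | z in Z]) <= m (sumset X Y) * m (sumset X Z).
Proof.
move=> cX cY cZ.
have cXY := compact_sumset _ _ _ cX cY; have cXZ := compact_sumset _ _ _ cX cZ.
have cYZ := compact_sumset _ _ _ cY (compact_opp _ _ cZ).
have MX := haar_compact _ cX.
apply: (@le_trans _ _ (m (sumset X Y) * m [set - q | q in sumset X Z])).
  apply: haar_convolution_le => //; first exact: haar_compact.
  move=> _ [y Yy [_ [z Zz <-] <-]].
  rewrite -(haar_m_translate y) //; apply: haar_mS.
  - by apply: (haar_translateM muH).
  - apply: haar_measurableI; first exact: haar_compact.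
    by apply: (haar_translateM muH); exact: haar_compact.
  move=> _ [x Xx <-]; split; first by rewrite addrC; exact: mem_sumset.
  exists (x + z); first exact: mem_sumset.
  by rewrite addrACA addNr addr0 addrC.
apply: ler_wpM2l; last exact: haar_m_opp_le.
exact/haar_m_ge0/haar_compact.
Qed.

(** * Petridis' argument and the inequality for compact sets *)

(* Petridis' lemma with a defect: [X] almost minimises [m (X + B) / m X], and
   the defect [delta] is paid once for each element of the finite set [s]. *)
Lemma haar_petridis X B K delta (s : seq G) : compact X -> open B ->
  (forall X', compact X' -> X' `<=` X -> K * m X' <= m (sumset X' B)) ->
  m (sumset X B) <= (K + delta) * m X ->
  m (sumset [set` s] (sumset X B)) <=
    K * m (sumset [set` s] X) + delta * (size s)%:R * m X.
Proof.
move=> cX oB minX XB.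
have MX := haar_compact _ cX.
have Mo E : M (sumset E B) by apply: (haar_open muH); exact: open_sumset.
have cs t : compact (sumset [set` (t : seq G)] X).
  by apply: compact_sumset => //; exact: compact_seq.
elim: s => [|c s IHs].
  rewrite (_ : [set` [::]] = set0); last by apply/seteqP; split.
  have s0 E : sumset set0 E = set0 by apply/seteqP; split=> // x [].
  by rewrite !s0 haar_m0 !(mulr0, mul0r, addr0).
pose S := [set` s].
(* [X'] is the part of [X] whose translate by [c] is already covered by [S + X]. *)
pose X' := X `&` [set - c + y | y in sumset S X].
have cX' : compact X'.
  apply: compact_closedI => //; apply: compact_closed => //.
  by apply: compact_translate; exact: cs.
have X'X : X' `<=` X by move=> x [].
have X'B : sumset X' B `<=` sumset X B by exact: sumsetS.
have MX' := haar_compact _ cX'.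
have cE E : sumset [set` c :: s] E = sumset S E `|` [set c + x | x in E].
  apply/seteqP; split=> [_ [a + [x Ex <-]]|_ [[a sa [x Ex <-]]|[x Ex <-]]].
  - rewrite /= inE => /predU1P[->|sa]; first by right; exists x.
    by left; exact: mem_sumset.
  - by apply: mem_sumset => //=; rewrite inE sa orbT.
  - by apply: mem_sumset => //=; rewrite inE eqxx.
have MS : M (sumset S X) by apply: haar_compact; exact: cs.
have McX : M [set c + x | x in X] by exact: (haar_translateM muH).
have McXB : M [set c + x | x in sumset X B] by exact: (haar_translateM muH).
have McX'B : M [set c + x | x in sumset X' B] by exact: (haar_translateM muH).
have MSB : M (sumset S (sumset X B)) by rewrite sumsetA.
have -> : m (sumset [set` c :: s] X) = m (sumset S X) + (m X - m X').
  rewrite cE haar_mUD //; congr (_ + _).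
  rewrite -(haar_m_translate c X) // -(haar_m_translate c X') //.
  rewrite (haar_mID [set c + x | x in X] (sumset S X)) //.
  rewrite (_ : _ `&` _ = [set c + x | x in X']) 1?addrAC ?subrr ?add0r //.
  apply/seteqP; split=> [_ [[x Xx <-] SXcx]|_ [x [Xx [y SXy yx]] <-]].
    exists x => //; split=> //; exists (c + x) => //; by rewrite addKr.
  by split; [exists x|rewrite -yx addNKr].
(* The translate [c + X' + B] is already in [S + X + B], so adding [c] gains at most
   [m (X + B) - m (X' + B)]. Minimality on [X'] bounds this by [K * (m X - m X') + delta * m X]. *)
have : m (sumset [set` c :: s] (sumset X B)) <=
    m (sumset S (sumset X B)) + (m (sumset X B) - m (sumset X' B)).
  rewrite cE haar_mUD // lerD2l.
  rewrite -(haar_m_translate c (sumset X B)) //.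
  rewrite -(haar_m_translate c (sumset X' B)) // -haar_mD //;
    last exact: image_subset.
  apply: haar_mS; [exact: haar_measurableD..|].
  apply: setDS => _ [_ [x [Xx [y SXy yx]] [b Bb <-]] <-].
  by rewrite addrA -yx addNKr sumsetA; exact: mem_sumset.
have := minX X' cX' X'X; rewrite /= -natr1.
move: IHs; rewrite -/S; nra.
Qed.

(** [K] is the infimum of the ratios over compact subsets of [A] of positive measure; it need not be
    attained. The slack is proportional to [beta - K], so that [delta] can be fixed before [K] and
    [X] are known. *)
Lemma haar_almost_minimal A B beta delta : compact A -> open B ->
  0 < m A -> m (sumset A B) < beta * m A -> 0 < delta ->
  exists K X, [/\ 0 <= K < beta, compact X /\ X `<=` A, 0 < m X,
    forall X', compact X' -> X' `<=` X -> K * m X' <= m (sumset X' B) &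
    m (sumset X B) <= (K + delta * (beta - K)) * m X].
Proof.
move=> cA oB mA AB d0.
have Mo E : M (sumset E B) by apply: (haar_open muH); exact: open_sumset.
pose ratios := [set m (sumset X B) / m X |
  X in [set X | [/\ compact X, X `<=` A & 0 < m X]]].
have lb0 : lbound ratios 0.
  by move=> _ [X [_ _ mX] <-]; apply: divr_ge0; [exact: haar_m_ge0|exact: ltW].
have rA : ratios (m (sumset A B) / m A).
  by exists A => //; split=> //; exact: subset_refl.
have infr : has_inf ratios by split; [eexists; exact: rA|exists 0].
pose K := inf ratios.
have Kb : K < beta.
  by apply: le_lt_trans (ge_inf infr.2 rA) _; rewrite ltr_pdivrMr.
have K0 : 0 <= K by apply: lb_le_inf infr.1 lb0.
have [|_ [X [cX XA mX] <-]] :=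
    @inf_adherent _ ratios (delta * (beta - K)) _ infr.
  by rewrite mulr_gt0 // subr_gt0.
rewrite -/K ltr_pdivrMr // => /ltW XK.
exists K, X; split=> //; first by rewrite K0.
move=> X' cX' X'X; have MX' := haar_compact _ cX'.
(* A null [X'] has no ratio in the infimum, but the inequality is then trivial. *)
have := haar_m_ge0 _ MX'; rewrite le_eqVlt => /predU1P[<-|mX'].
  by rewrite mulr0 haar_m_ge0.
rewrite -ler_pdivlMr //; apply: ge_inf infr.2 _ _; exists X' => //.
by split=> //; exact: subset_trans XA.
Qed.

Lemma haar_plunnecke_lt A B b0 beta k l : compact A -> compact B -> B b0 ->
  0 < m A -> m (sumset A B) < beta * m A ->
  m (diffsumset k l B) <= beta ^+ (k + l) * m A.
Proof.
move=> cA cB Bb0 mA AB; pose N := maxn k l.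
have cAB := compact_sumset _ _ _ cA cB.
have [|W [oW ABW Wb]] := haar_outer_lt (sumset A B) (beta * m A).
  by rewrite haar_outerE //; exact: haar_compact.
have [U [oU U0 ABUW]] := compact_sub_open _ _ _ cAB oW ABW.
pose B' := sumset B U.
have oB' : open B' by exact: open_sumset.
have AB' : m (sumset A B') < beta * m A.
  apply: le_lt_trans Wb; apply: haar_mS; [|exact: (haar_open muH)|].
    by apply: (haar_open muH); exact: open_sumset.
  by rewrite /B' sumsetA.
have [V [oV V0 VU]] := nbhs0_nsumset _ N _ (open_nbhs_nbhs (conj oU U0)).
have [s [sB BsV]] := compact_finite_cover _ _ _ cB oV V0.
(* Including [b0] keeps [F] nonempty, so each [jF] contains a point and [m X <= m (jF + X)]. *)
pose F := b0 :: s.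
have FB : [set` F] `<=` B by move=> x; rewrite /= inE => /predU1P[->|/sB].
have BFV : B `<=` sumset [set` F] V.
  by apply: subset_trans BsV _; apply: sumsetS => // x xs;
    rewrite /= inE xs orbT.
have FB' : [set` F] `<=` B'.
  by move=> x /FB Bx; rewrite -[x]addr0; exact: mem_sumset.
have /choice[t_ t_E] := fun j => nsumset_seq _ j F.
(* [q] is positive and exceeds the size of every list [t_ j] with [j < N]. With [delta = 1 / q], the
   total error in each Petridis step is at most [(beta - K) * m X], which raises the factor [K] to
   at most [beta]. *)
pose q := (\sum_(j < N) size (t_ j)).+1.
have [|K [X [/andP[K0 Kb] [cX XA] mX minX XB']]] :=
  haar_almost_minimal A B' beta q%:R^-1 cA oB' mA AB'.
  by rewrite invr_gt0.
have beta0 : 0 <= beta by rewrite (le_trans K0) // ltW.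
have MX := haar_compact _ cX.
have cF := compact_seq _ F.
have MFX j : M (sumset (nsumset j [set` F]) X).
  by apply/haar_compact/compact_sumset => //; exact: compact_nsumset.
have MFXB j : M (sumset (nsumset j [set` F]) (sumset X B')).
  by apply: (haar_open muH); rewrite sumsetA; exact: open_sumset.
have F0 j : exists b, nsumset j [set` F] b.
  elim: j => [|j [b Fb]]; first by exists 0.
  by exists (b0 + b); apply: mem_sumset => //=; rewrite inE eqxx.
have step j : (j < N)%N -> m (sumset (nsumset j [set` F]) (sumset X B')) <=
    beta * m (sumset (nsumset j [set` F]) X).
  move=> jN; have := haar_petridis X B' K _ (t_ j) cX oB' minX XB'.
  rewrite -t_E => /le_trans; apply.
  have XFX : m X <= m (sumset (nsumset j [set` F]) X).
    have [b Fb] := F0 j; rewrite -(haar_m_translate b) //; apply: haar_mS => //.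
      exact: (haar_translateM muH).
    by move=> _ [x Xx <-]; exact: mem_sumset.
  have tq : q%:R^-1 * (size (t_ j))%:R <= 1 :> R.
    rewrite mulrC ler_pdivrMr ?mul1r ?ltr0n // ler_nat.
    rewrite /q (bigD1 (Ordinal jN)) //=; apply: leqW; exact: leq_addr.
  have bK : 0 <= beta - K by rewrite subr_ge0 ltW.
  have : q%:R^-1 * (beta - K) * (size (t_ j))%:R * m X <= (beta - K) * m X.
    rewrite ler_pM2r // mulrAC -[leRHS]mul1r; exact: ler_wpM2r.
  move: XFX bK; nra.
(* Induction through [(j + 1)F + X], which lies in [jF + X + B'] because [F] lies in [B']. *)
have FX j : (j <= N)%N -> m (sumset (nsumset j [set` F]) X) <= beta ^+ j * m X.
  elim: j => [_|j IHj jN]; first by rewrite sumsetC sumset0 mul1r.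
  apply: (@le_trans _ _ (m (sumset (nsumset j [set` F]) (sumset X B')))).
    apply: haar_mS; [exact: (MFX j.+1)|exact: MFXB|].
    rewrite /= -sumsetA sumsetC [X in _ `<=` X]sumsetA.
    exact: sumsetS.
  apply: le_trans (step j jN) _; rewrite exprS -mulrA.
  by apply: ler_wpM2l => //; apply: IHj; exact: ltnW.
(* One copy of [B] is kept and the other [j] are replaced by [F + V]; as [jV] lies in [U], the set
   [X + (j + 1)B] lies in [jF + X + (B + U)]. *)
have XB j : (j <= N)%N -> m (sumset X (nsumset j B)) <= beta ^+ j * m X.
  case: j => [_|j jN]; first by rewrite sumset0 mul1r.
  apply: (@le_trans _ _ (m (sumset (nsumset j [set` F]) (sumset X B')))).
    apply: haar_mS => //.
      by apply/haar_compact/compact_sumset => //; exact: compact_nsumset.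
    rewrite [X in _ `<=` X]sumsetC -sumsetA; apply: sumsetS => //=.
    rewrite /B' -sumsetA; apply: sumsetS => //; rewrite [X in _ `<=` X]sumsetC.
    apply: subset_trans (nsumsetS _ _ _ _ BFV) _.
    apply: subset_trans (nsumset_sumset _ _ _ _) _.
    by apply: sumsetS => //; apply: VU; exact: ltnW.
  apply: le_trans (step j jN) _; rewrite exprS -mulrA.
  by apply: ler_wpM2l => //; apply: FX; exact: ltnW.
have cn j := compact_nsumset _ j _ cB.
have Ruz := haar_ruzsa_triangle _ _ _ cX (cn k) (cn l).
have : m (diffsumset k l B) <= beta ^+ (k + l) * m X.
  rewrite -(ler_pM2l mX); apply: le_trans Ruz _.
  rewrite exprD (_ : _ * (_ * _) = (beta ^+ k * m X) * (beta ^+ l * m X));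
    last by ring.
  apply: ler_pM; [exact/haar_m_ge0/haar_compact/compact_sumset..| |].
    by apply: XB; exact: leq_maxl.
  by apply: XB; exact: leq_maxr.
move=> /le_trans; apply; apply: ler_wpM2l; first exact: exprn_ge0.
by apply: haar_mS => //; exact: haar_compact.
Qed.

End haar_measure.

(** * Passage to the limit and reduction to compact sets *)

Import numFieldNormedType.Exports.

(** The compact case needs a strict inequality; it is applied with [beta > alpha], and [beta] then
    tends to [alpha] from the right. *)
Lemma ler_exprM_right (R : realType) (t a alpha : R) n :
  (forall beta, alpha < beta -> t <= beta ^+ n * a) -> t <= alpha ^+ n * a.
Proof.
move=> tb; have cv : x ^+ n * a @[x --> alpha^'+] --> alpha ^+ n * a.
  apply: cvg_at_right_filter; apply: cvgM; last exact: cvg_cst.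
  exact: exprn_continuous.
rewrite -(cvg_lim _ cv) //; apply: limr_ge.
  by apply/cvg_ex; eexists; exact: cv.
by near=> b; apply: tb; near: b; exact: nbhs_right_gt.
Unshelve. all: by end_near. Qed.

Theorem theorem1p3 (R : realType) (G : topologicalZmodType)
    (M : set (set G)) (mu : set G -> \bar R) (alpha : R) (A B : set G) :
  hausdorff_space G -> compact [set: G] ->
  haar_probability M mu ->
  K_analytic A -> K_analytic B ->
  (0 < mu (sumset A B))%E -> (mu (sumset A B) <= alpha%:E * mu A)%E ->
  forall m n : nat, (mu (diffsumset m n B) <= (alpha ^+ (m + n))%:E * mu A)%E.
Proof.
move=> hG cG muH kA kB AB0 ABalpha k l.
have K_M E : K_analytic E -> M E := haar_K_analytic _ _ _ _ hG muH E.
have mE E (kE : K_analytic E) : mu E = (fine (mu E))%:E.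
  exact: haar_muE _ _ _ _ muH E (K_M E kE).
have kAB := K_analytic_sumset _ _ _ kA kB.
have kD := K_analytic_diffsumset _ k l _ hG cG kB.
move: AB0 ABalpha; rewrite (mE _ kAB) (mE _ kA) (mE _ kD) -!EFinM.
rewrite lte_fin !lee_fin => AB0 ABalpha.
have mA0 : 0 < fine (mu A).
  rewrite lt_neqAle (haar_m_ge0 _ _ _ _ muH) ?andbT //; last exact: K_M.
  apply: contraTneq AB0 => A0; rewrite -leNgt.
  by rewrite (le_trans ABalpha) // -A0 mulr0.
have alpha0 : 0 < alpha.
  by rewrite -(pmulr_lgt0 _ mA0); exact: lt_le_trans AB0 _.
apply: ler_exprM_right => beta ab.
apply/ler_addgt0Pr => e e0; rewrite -lerBlDr.
have [b0 Bb0] : exists b, B b.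
  apply: contrapT => /forallNP B0; move: AB0.
  rewrite (_ : sumset A B = set0) ?(haar_mu0 muH) ?ltxx //.
  by apply/seteqP; split=> // x [a _ [b /B0]].
have [|C [cC CB tC]] := haar_diffsumset_inner _ _ _ _ hG cG muH k l B
  (fine (mu (diffsumset k l B)) - e) kB.
  by rewrite ltrBlDr ltrDl.
(* Adding [b0] makes the compact part of [B] nonempty. *)
have cC' : compact (C `|` [set b0]).
  by apply: compactU => //; exact: compact_set1.
have C'B : C `|` [set b0] `<=` B by move=> x [/CB|->].
(* A compact [A'] in [A] of measure above [t] satisfies [alpha * mu A < beta * mu A'], which gives
   the strict hypothesis for [A']. Inner approximation yields only a weak inequality, so it is used
   at the midpoint of [t] and [mu A]. *)
pose t := alpha * fine (mu A) / beta.
have beta0 : 0 < beta by exact: lt_trans ab.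
have [|A' [cA' A'A tA']] :=
  haar_K_analytic_inner _ _ _ _ hG muH A ((t + fine (mu A)) / 2) kA.
  rewrite (haar_outerE _ _ _ _ muH) //; last exact: K_M.
  have : t < fine (mu A) by rewrite ltr_pdivrMr // mulrC ltr_pM2l.
  lra.
have tA : t < fine (mu A) by rewrite ltr_pdivrMr // mulrC ltr_pM2l.
have t0 : 0 <= t by rewrite divr_ge0 ?mulr_ge0 ?ltW.
have tA'' : t < fine (mu A') by lra.
have M_c E : compact E -> M E by exact: haar_compact _ _ _ _ hG muH E.
apply: le_trans tC _.
apply: (@le_trans _ _ (fine (mu (diffsumset k l (C `|` [set b0]))))).
  apply: (haar_mS _ _ _ _ muH); [by apply: M_c; exact: compact_diffsumset..|].
  by apply: diffsumsetS => x; left.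
apply: (@le_trans _ _ (beta ^+ (k + l) * fine (mu A'))).
  apply: (haar_plunnecke_lt _ _ _ _ hG cG muH _ _ b0) => //.
  - by right.
  - exact: le_lt_trans tA''.
  apply: (@le_lt_trans _ _ (alpha * fine (mu A))).
    apply: le_trans ABalpha; apply: (haar_mS _ _ _ _ muH).
    - by apply: M_c; exact: compact_sumset.
    - exact: K_M.
    - exact: sumsetS.
  by rewrite -ltr_pdivrMl // mulrC.
apply: ler_wpM2l; first by rewrite exprn_ge0 // ltW.
by apply: (haar_mS _ _ _ _ muH) => //; [exact: M_c|exact: K_M].
Qed.
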